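(* Let $N,n,m,\tau_{\mathrm h}$ be positive integers, $\varepsilon>0$, $\boldsymbol{A}_i\in\mathbb{R}^{n\times n}$, $\boldsymbol{B}_i\in\mathbb{R}^{n\times m}$ for $i\in\{1,\dots,N\}$, and $x_1^{\mathsf d},\dots,x_N^{\mathsf d}\in\mathbb{R}^n$. Suppose that for every $i$ the reachability Gramian $\boldsymbol{G}_{i,\tau_{\mathrm h}}:=\sum_{k=0}^{\tau_{\mathrm h}-1}\boldsymbol{A}_i^k\boldsymbol{B}_i\boldsymbol{B}_i^\top(\boldsymbol{A}_i^\top)^k$ is invertible, and that for all $i,j$ there exists $\bar{\boldsymbol u}_{ij}\in\mathbb{R}^m$ such that $\boldsymbol{A}_ix_j^{\mathsf d}+\boldsymbol{B}_i\bar{\boldsymbol u}_{ij}=x_j^{\mathsf d}$. Let $\bar{\boldsymbol A}_i$, $\rho_i$, $\bar r$ and the closed-loop system (S) be as defined in the context. Then, for any $\delta>0$, any initial states $\{x_i^0\}_{i=1}^N\subset\mathbb{R}^n$, and any $\{\nu_i\}_{i=1}^N$ satisfying $\nu_i>0$ and $\rho_i+\nu_i<1$ for all $i\in\{1,\dots,N\}$, there exist constants $\kappa_i=\kappa_i(\nu_i)>0$, $i\in\{1,\dots,N\}$ (depending on $\nu_i$, not on $\delta$ or $\{x_i^0\}$), and $\tau=\tau(\delta,\{x_i^0\},\{\nu_i\})\in\mathbb{Z}_{>0}$ such that the solution $\boldsymbol{x}[k]=[\boldsymbol{x}_1[k];\cdots;\boldsymbol{x}_N[k]]$ of (S) with $\boldsymbol{x}_i[0]=x_i^0$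 satisfies $$\|\boldsymbol{x}_i[k]\|<\delta+\frac{\kappa_i\,\bar r\,\|I-\bar{\boldsymbol A}_i\|_2}{1-(\rho_i+\nu_i)},\qquad \forall k\ge\tau,\ \forall i\in\{1,\dots,N\}.$$
   Context: Notation: $[x_1;\cdots;x_N]$ is the stacked column vector; $\mathbf{1}_N$ is the $N$-vector of ones; $\oslash$ is element-wise division; for $\alpha\in\mathbb{R}^N$, $\operatorname{diag}(\alpha)$ is the diagonal matrix with diagonal entries $\alpha_1,\dots,\alpha_N$; $\|\cdot\|$ is the Euclidean norm, $\|\cdot\|_2$ the induced matrix norm, and $\|v\|_G:=(v^\top Gv)^{1/2}$ for positive semidefinite $G$. Define $$\bar{\boldsymbol A}_i:=\boldsymbol{A}_i-\boldsymbol{B}_i\boldsymbol{B}_i^\top(\boldsymbol{A}_i^\top)^{\tau_{\mathrm h}-1}\boldsymbol{G}_{i,\tau_{\mathrm h}}^{-1}\boldsymbol{A}_i^{\tau_{\mathrm h}},\qquad \mathcal{G}_i:=(\boldsymbol{A}_i^{\tau_{\mathrm h}})^\top\boldsymbol{G}_{i,\tau_{\mathrm h}}^{-1}\boldsymbol{A}_i^{\tau_{\mathrm h}},$$ let $\rho_i$ be the spectral radius of $\bar{\boldsymbol A}_i$ (under the stated hypotheses $\rho_i<1$), and let $\bar r:=\max_{j}\|x_j^{\mathsf d}\|$. For $x=[x_1;\cdots;x_N]\in\mathbb{R}^{nN}$ and $\beta\in\mathbb{R}_{>0}^N$ define $$\boldsymbol{K}(x)=(\boldsymbol{K}_{ij}(x))\in\mathbb{R}_{>0}^{N\times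 N},\quad \boldsymbol{K}_{ij}(x):=\exp\bigl(-\|x_i-x_j^{\mathsf d}\|_{\mathcal{G}_i}^2/\varepsilon\bigr),$$ $$f(x,\beta):=\mathbf{1}_N/N\oslash\bigl[\boldsymbol{K}(x)^\top(\mathbf{1}_N/N\oslash[\boldsymbol{K}(x)\beta])\bigr],\qquad \widetilde P(x,\beta):=\operatorname{diag}\bigl(\mathbf{1}_N/N\oslash[\boldsymbol{K}(x)\beta]\bigr)\boldsymbol{K}(x)\,\operatorname{diag}(\beta),$$ and the barycentric target $x_i^{\rm tmp}(P):=N\sum_{j=1}^NP_{ij}x_j^{\mathsf d}$ for $P\in\mathbb{R}_{\ge0}^{N\times N}$. The closed-loop system (S) (generalized Sinkhorn MPC with one Sinkhorn iteration per time step) is, for $k\in\mathbb{Z}_{\ge0}$, $$\boldsymbol{x}_i[k+1]=\bar{\boldsymbol A}_i\boldsymbol{x}_i[k]+(I-\bar{\boldsymbol A}_i)\,x_i^{\rm tmp}\bigl(\widetilde P(\boldsymbol{x}[k],\beta[k])\bigr),\ i\in\{1,\dots,N\},\qquad \beta[k+1]=f(\boldsymbol{x}[k+1],\beta[k]),$$ with $\beta[0]\in\mathbb{R}_{>0}^N$ an arbitrary initial value, where $\beta$ is regarded up to multiplication by a positive scalar. *)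

(* Defs.v *)
(* A stacked vector [x_1; ...; x_N] is represented by the family of its blocks,
   of type 'I_N -> 'cV[R]_n. *)
From mathcomp Require Import all_boot all_order all_algebra.
From mathcomp Require Import complex.
From mathcomp Require Import all_classical all_reals all_analysis.

Set Implicit Arguments.
Unset Strict Implicit.
Unset Printing Implicit Defensive.

Import Order.TTheory GRing.Theory Num.Theory.

Local Open Scope classical_set_scope.
Local Open Scope ring_scope.

Section Norms.
Context {R : realType}.

(* The library norm on matrices is the sup norm, hence this definition. *)
Definition enorm n (v : 'cV[R]_n) : R := Num.sqrt (\sum_(i < n) v i 0 ^+ 2).

Definition opnorm2 p q (M : 'M[R]_(p, q)) : R :=
  sup [set enorm (M *m v) | v in [set v : 'cV[R]_q | enorm v <= 1]].

Definition wnorm n (G : 'M[R]_n) (v : 'cV[R]_n) : R :=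
  Num.sqrt ((v^T *m G *m v) 0 0).

(* The eigenvalues are the complex ones, although the entries of M are real. *)
Definition spectral_radius n (M : 'M[R]_n) : R :=
  sup [set ComplexField.Normc.normc l |
       l in [set l : R[i] | eigenvalue (map_mx (real_complex R) M) l]].

End Norms.

Section Agent.
Context {R : realType} {n m : nat}.
Variables (tauh : nat) (A : 'M[R]_n) (B : 'M[R]_(n, m)).

Definition gramian : 'M[R]_n :=
  \sum_(k < tauh) A ^+ k *m B *m B^T *m A^T ^+ k.

Definition Abar : 'M[R]_n :=
  A - B *m B^T *m A^T ^+ tauh.-1 *m invmx gramian *m A ^+ tauh.

Definition cost_weight : 'M[R]_n :=
  (A ^+ tauh)^T *m invmx gramian *m A ^+ tauh.

End Agent.

Section Sinkhorn.
Context {R : realType} {N : nat}.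

Definition positive_vec (v : 'cV[R]_N) : Prop := forall i, 0 < v i 0.

Definition eldiv (u v : 'cV[R]_N) : 'cV[R]_N := \col_i (u i 0 / v i 0).

Definition uniform_vec : 'cV[R]_N := const_mx (1 / N%:R).

Definition sinkhorn_f (K : 'M[R]_N) (beta : 'cV[R]_N) : 'cV[R]_N :=
  eldiv uniform_vec (K^T *m eldiv uniform_vec (K *m beta)).

Definition sinkhorn_plan (K : 'M[R]_N) (beta : 'cV[R]_N) : 'M[R]_N :=
  diag_mx (eldiv uniform_vec (K *m beta))^T *m K *m diag_mx beta^T.

(* Equality in the quotient of the positive cone by positive scalars. *)
Definition proportional (beta beta' : 'cV[R]_N) : Prop :=
  exists2 c : R, 0 < c & beta = c *: beta'.

End Sinkhorn.

Section ClosedLoop.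
Context {R : realType} {N n m : nat}.
Variables (tauh : nat) (eps : R).
Variables (A : 'I_N -> 'M[R]_n) (B : 'I_N -> 'M[R]_(n, m)).
Variable xd : 'I_N -> 'cV[R]_n.

Definition Kmat (x : 'I_N -> 'cV[R]_n) : 'M[R]_N :=
  \matrix_(i, j)
    expR (- (wnorm (cost_weight tauh (A i) (B i)) (x i - xd j) ^+ 2 / eps)).

Definition xtmp (P : 'M[R]_N) (i : 'I_N) : 'cV[R]_n :=
  N%:R *: \sum_(j < N) P i j *: xd j.

Definition rbar : R := \big[Num.max/0]_(j < N) enorm (xd j).

Definition closed_loop (x : nat -> 'I_N -> 'cV[R]_n) (beta : nat -> 'cV[R]_N)
    : Prop :=
  [/\ positive_vec (beta 0%N),
      forall k i,
        x k.+1 i = Abar tauh (A i) (B i) *m x k i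
          + (1%:M - Abar tauh (A i) (B i))
            *m xtmp (sinkhorn_plan (Kmat (x k)) (beta k)) i
    & forall k,
        proportional (beta k.+1) (sinkhorn_f (Kmat (x k.+1)) (beta k))].

End ClosedLoop.

(* Main.v *)
Require Import Defs.
From mathcomp Require Import all_boot all_order all_algebra.
From mathcomp Require Import complex.
From mathcomp Require Import all_classical all_reals all_analysis.
From mathcomp Require Import ring.

Import Order.TTheory GRing.Theory Num.Theory.

Local Open Scope ring_scope.

(** One Sinkhorn iteration normalizes the rows of the plan: each row of
[sinkhorn_plan K beta] sums to 1 / N whatever the positive vector beta is.
Hence every barycentric target is a convex combination of the destinations and
has norm at most [rbar xd] ([enorm_xtmp_le]), at every time and regardless of
how beta evolves, as long as beta stays positive
([closed_loop_beta_positive]).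

Each agent therefore follows a linear recursion
x (k + 1) = M x k + (1 - M) w k with M the closed-loop matrix and w bounded by
[rbar xd]. The claim follows from the power bound
|M ^ k v| <= kappa (rho + nu) ^ k |v| ([enorm_pow_mulmx_le]) by summing a
geometric series ([affine_recursion_bound]); the contribution of the initial
state tends to 0 and is eventually below delta.

The power bound comes from the Cayley-Hamilton theorem over the complex
numbers. If l is one of the roots of the characteristic polynomial, then
a k = M ^ k V satisfies a (k + 1) = l a k + M ^ k (M - l) V, where (M - l) V is
annihilated by a product with one factor fewer. Induction on the number of
factors gives a bound by a multiple of r ^ k, for every r larger than all the
moduli |l| ([pow_mulmx_bound]). The spectral radius bounds these moduli, so
r = rho + nu is allowed, and the constant depends only on M and nu. *)

(** * Euclidean norm and its induced matrix norm *)

Section EuclideanNorm.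
Context {R : realType}.

Lemma sumsqr_ge0 n (v : 'cV[R]_n) : 0 <= \sum_(i < n) v i 0 ^+ 2.
Proof. by apply: sumr_ge0 => i _; apply: sqr_ge0. Qed.

Lemma enorm_ge0 n (v : 'cV[R]_n) : 0 <= enorm v.
Proof. exact: sqrtr_ge0. Qed.

Lemma enorm_sqr n (v : 'cV[R]_n) : enorm v ^+ 2 = \sum_(i < n) v i 0 ^+ 2.
Proof. by rewrite sqr_sqrtr // sumsqr_ge0. Qed.

Lemma enorm_le_sqr n (v : 'cV[R]_n) (c : R) :
  0 <= c -> (enorm v <= c) = (\sum_(i < n) v i 0 ^+ 2 <= c ^+ 2).
Proof. by move=> c0; rewrite -enorm_sqr ler_pXn2r // nnegrE enorm_ge0. Qed.

Lemma enorm0 n : enorm (0 : 'cV[R]_n) = 0.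
Proof.
by rewrite /enorm big1 ?sqrtr0 // => i _; rewrite mxE expr0n.
Qed.

Lemma enormZ n (a : R) (v : 'cV[R]_n) : enorm (a *: v) = `|a| * enorm v.
Proof.
rewrite /enorm -sqrtr_sqr -sqrtrM ?sqr_ge0 // mulr_sumr.
by congr Num.sqrt; apply: eq_bigr => i _; rewrite mxE exprMn.
Qed.

Lemma normr_le_enorm n (v : 'cV[R]_n) i : `|v i 0| <= enorm v.
Proof.
rewrite -sqrtr_sqr ler_sqrt ?sumsqr_ge0 // (bigD1 i) //= lerDl.
by apply: sumr_ge0 => j _; apply: sqr_ge0.
Qed.

Lemma enorm_eq0 n (v : 'cV[R]_n) : enorm v = 0 -> v = 0.
Proof.
move=> v0; apply/colP => i; rewrite mxE; apply/eqP.
by rewrite -normr_le0 -v0 normr_le_enorm.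
Qed.

Lemma enormD n (u v : 'cV[R]_n) : enorm (u + v) <= enorm u + enorm v.
Proof.
have [/enorm_eq0 ->|u0] := eqVneq (enorm u) 0; first by rewrite enorm0 !add0r.
have [/enorm_eq0 ->|v0] := eqVneq (enorm v) 0; first by rewrite enorm0 !addr0.
rewrite enorm_le_sqr ?addr_ge0 ?enorm_ge0 //.
have {u0}a0 : 0 < enorm u by rewrite lt_def u0 enorm_ge0.
have {v0}b0 : 0 < enorm v by rewrite lt_def v0 enorm_ge0.
move: (enorm_sqr _ u) (enorm_sqr _ v).
set a := enorm u in a0 *; set b := enorm v in b0 * => ea eb.
(* Convexity of the square, with weights a / (a + b) and b / (a + b). *)
have -> : (a + b) ^+ 2 =
    \sum_(i < n) ((a + b) / a * u i 0 ^+ 2 + (a + b) / b * v i 0 ^+ 2).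
  rewrite big_split /= -!mulr_sumr -ea -eb.
  by field; rewrite !gt_eqF.
apply: ler_sum => i _; rewrite mxE -subr_ge0.
have -> : (a + b) / a * u i 0 ^+ 2 + (a + b) / b * v i 0 ^+ 2
    - (u i 0 + v i 0) ^+ 2 = (b * u i 0 - a * v i 0) ^+ 2 / (a * b).
  by field; rewrite !gt_eqF.
by rewrite divr_ge0 ?sqr_ge0 // mulr_ge0 // ltW.
Qed.

Lemma enorm_sum n (I : finType) (v : I -> 'cV[R]_n) :
  enorm (\sum_i v i) <= \sum_i enorm (v i).
Proof.
elim/big_ind2: _ => [|a u b v' hu hv|//]; first by rewrite enorm0.
exact: le_trans (enormD _ _ _) (lerD hu hv).
Qed.

Lemma enorm_le_sum n (v : 'cV[R]_n) : enorm v <= \sum_i `|v i 0|.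
Proof.
rewrite {1}(matrix_sum_delta v) exchange_big big_ord1.
apply: le_trans (enorm_sum _ _ _) _; apply: ler_sum => i _.
rewrite enormZ ler_piMr // enorm_le_sqr // expr1n (bigD1 i) //= big1 ?addr0.
  by rewrite mxE !eqxx expr1n.
by move=> j ji; rewrite mxE (negPf ji) expr0n.
Qed.

(** A crude bound by the largest entry, up to a dimensional constant. *)
Lemma enorm_mulmx_le p q (M : 'M[R]_(p, q)) (c : R) (v : 'cV[R]_q) :
  (forall i j, `|M i j| <= c) -> enorm (M *m v) <= (p * q)%:R * c * enorm v.
Proof.
move=> hM; apply: le_trans (enorm_le_sum _ _) _.
have -> : (p * q)%:R * c * enorm v = \sum_(i < p) \sum_(j < q) c * enorm v.
  by rewrite !sumr_const !card_ord -mulrnA -[RHS]mulr_natl mulnC mulrA.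
apply: ler_sum => i _; rewrite mxE; apply: le_trans (ler_norm_sum _ _ _) _.
apply: ler_sum => j _; rewrite normrM ler_pM //; exact: normr_le_enorm.
Qed.

(** [opnorm2] is a supremum, so the bound needs the image of the unit ball to
be bounded as well as a rescaling of v. *)
Lemma enorm_mulmx_le_opnorm2 p q (M : 'M[R]_(p, q)) (v : 'cV[R]_q) :
  enorm (M *m v) <= opnorm2 M * enorm v.
Proof.
have [/enorm_eq0 ->|v0] := eqVneq (enorm v) 0.
  by rewrite mulmx0 !enorm0 mulr0.
have {v0}v0 : 0 < enorm v by rewrite lt_def v0 enorm_ge0.
rewrite -ler_pdivrMr // mulrC -[_^-1]gtr0_norm ?invr_gt0 // -enormZ scalemxAr.
apply: ub_le_sup; last first.
  exists ((enorm v)^-1 *: v) => //=.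
  by rewrite enormZ gtr0_norm ?invr_gt0 // mulVf // gt_eqF.
(* The sum of the absolute values of all entries bounds each of
   them. *)
pose c := \sum_i \sum_j `|M i j|.
have hc i j : `|M i j| <= c.
  rewrite /c (bigD1 i) //= (bigD1 j) //= -addrA lerDl addr_ge0 // sumr_ge0 //.
  by move=> k _; rewrite sumr_ge0.
exists ((p * q)%:R * c) => _ [w /= w1 <-].
apply: le_trans (enorm_mulmx_le _ _ M c w hc) _.
rewrite ler_piMr // mulr_ge0 //.
by rewrite /c sumr_ge0 // => i _; rewrite sumr_ge0.
Qed.

End EuclideanNorm.

(** * Growth of the powers of a matrix *)

Section Powers.

(** If V is annihilated by a product of factors M - l with all |l| < r, then the
entries of M ^ k V grow at most like r ^ k. The matrix V is general for the
sake of the induction, which replaces V by (M - l) V. *)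
Lemma pow_mulmx_bound (C : numClosedFieldType) n (M : 'M[C]_n.+1) (r : C)
    (s : seq C) (V : 'M[C]_n.+1) :
  (forall l, l \in s -> `|l| < r) ->
  horner_mx M (\prod_(l <- s) ('X - l%:P)) *m V = 0 ->
  exists2 c : C, 0 <= c &
    forall k i j, `|(M ^+ k *m V) i j| <= c * r ^+ k.
Proof.
elim: s V => [|l s IH] V hs.
  rewrite big_nil rmorph1 mul1mx => ->; exists 0 => // k i j.
  by rewrite mulmx0 mxE normr0 mul0r.
rewrite big_cons mulrC rmorphM /= -mulmxA => hV.
have [t ts|c c0 hc] := IH _ _ hV; first by rewrite hs // inE ts orbT.
have lr : `|l| < r by rewrite hs // mem_head.
have r0 : 0 < r by apply: le_lt_trans lr.
have rl0 : 0 < r - `|l| by rewrite subr_gt0.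
pose S := \sum_i \sum_j `|V i j|.
have S0 : 0 <= S by rewrite sumr_ge0 // => i _; rewrite sumr_ge0.
have hS i j : `|V i j| <= S.
  rewrite /S (bigD1 i) //= (bigD1 j) //= -addrA lerDl addr_ge0 // sumr_ge0 //.
  by move=> k _; rewrite sumr_ge0.
pose d := S + c / (r - `|l|).
have d0 : 0 <= d by rewrite addr_ge0 // divr_ge0 // ltW.
(* The choice of d makes the sequence d * r ^+ k a supersolution of the
   recursion a_(k+1) = `|l| * a_k + c * r ^+ k. *)
have hd : c <= (r - `|l|) * d.
  rewrite mulrDr mulrCA divff ?gt_eqF // mulr1 lerDr mulr_ge0 //.
  exact: ltW.
exists d => // k i j; elim: k => [|k IHk].
  by rewrite !expr0 mul1mx mulr1 (le_trans (hS i j)) // lerDl divr_ge0 // ltW.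
have -> : (M ^+ k.+1 *m V) i j = l * (M ^+ k *m V) i j +
    (M ^+ k *m (horner_mx M ('X - l%:P) *m V)) i j.
  rewrite rmorphB /= horner_mx_X horner_mx_C mulmxBl mulmxBr mul_scalar_mx.
  rewrite -scalemxAr mulmxA -[M ^+ k *m M]/(M ^+ k * M) -exprSr !mxE; ring.
apply: le_trans (ler_normD _ _) _; rewrite normrM.
apply: le_trans (lerD (ler_wpM2l (normr_ge0 l) IHk) (hc k i j)) _.
rewrite exprS mulrA mulrCA mulrA -mulrDl ler_wpM2r ?exprn_ge0 ?(ltW r0) //.
by rewrite mulrC [d * r]mulrC -lerBrDl -mulrBl.
Qed.

Context {R : realType}.
Local Notation C := R[i].
Local Notation toC := (real_complex R).
Local Notation normc := (ComplexField.Normc.normc).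

Lemma normc_ge0 (z : C) : 0 <= normc z.
Proof. by rewrite -lecR; exact: (normr_ge0 z). Qed.

(** The spectral radius is a supremum over a bounded set, since all eigenvalues
are among the finitely many roots of the characteristic polynomial. *)
Lemma spectral_radius_ub n (M : 'M[R]_n) (l : C) :
  eigenvalue (map_mx toC M) l -> normc l <= spectral_radius M.
Proof.
move=> hl; apply: ub_le_sup; last by exists l.
have [s hs] := closed_field_poly_normal (char_poly (map_mx toC M)).
exists (\sum_(z <- s) normc z) => _ [z /= hz <-].
have zs : z \in s.
  move: hz; rewrite eigenvalue_root_char hs (monicP (char_poly_monic _)) scale1r.
  by rewrite root_prod_XsubC.
by rewrite (big_rem z) //= lerDl sumr_ge0 // => w _; apply: normc_ge0.
Qed.

Lemma spectral_radius_ge0 n (M : 'M[R]_n) : 0 <= spectral_radius M.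
Proof.
have [[l hl]|no_eig] :=
    pselect (exists l, eigenvalue (map_mx toC M) l).
  exact: le_trans (normc_ge0 l) (spectral_radius_ub _ _ _ hl).
rewrite /spectral_radius (_ : [set _ | _ in _]%classic = set0) ?sup0 //.
by apply/seteqP; split=> // a [l hl _]; case: no_eig; exists l.
Qed.

(** The quantitative form of Gelfand's formula used here; kappa depends on M and
nu only. *)
Lemma enorm_pow_mulmx_le n (M : 'M[R]_n) (nu : R) : 0 < nu ->
  exists2 kappa : R, 0 < kappa & forall k (v : 'cV[R]_n),
    enorm (M ^+ k *m v) <= kappa * (spectral_radius M + nu) ^+ k * enorm v.
Proof.
move=> nu0; have r0 : 0 < spectral_radius M + nu.
  by rewrite ltr_wpDl // spectral_radius_ge0.
(* Evaluating a polynomial at a matrix requires a positive size. *)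
case: n M r0 => [|n] M r0.
  by exists 1 => // k v; rewrite (flatmx0 (_ *m _)) (flatmx0 v) !enorm0 mulr0.
set r := _ + nu in r0 *.
pose MC := map_mx toC M.
have [s hs] := closed_field_poly_normal (char_poly MC).
rewrite (monicP (char_poly_monic _)) scale1r in hs.
have hs_lt l : l \in s -> `|l| < toC r.
  move=> ls; rewrite -[`|l|]/((normc l)%:C%C) ltcR.
  apply: (@le_lt_trans _ _ (spectral_radius M)); last by rewrite ltrDl.
  by apply: spectral_radius_ub; rewrite eigenvalue_root_char hs root_prod_XsubC.
have [|c c0 hc] := pow_mulmx_bound _ _ MC (toC r) s 1%:M hs_lt.
  by rewrite -hs Cayley_Hamilton mul0mx.
have normc0 := normc_ge0 c.
have hM k i j : `|(M ^+ k) i j| <= normc c * r ^+ k.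
  rewrite -lecR rmorphM rmorphXn /= -[(normc c)%:C%C]/(`|c|) (ger0_norm c0).
  have := hc k i j; rewrite mulmx1 -rmorphXn mxE.
  by rewrite normc_def /= expr0n addr0 sqrtr_sqr.
exists (((n.+1 * n.+1)%:R * normc c) + 1).
  by rewrite ltr_wpDl // mulr_ge0.
move=> k v; apply: le_trans (enorm_mulmx_le _ _ _ _ v (hM k)) _.
rewrite mulrA ler_wpM2r ?enorm_ge0 // ler_wpM2r ?exprn_ge0 ?(ltW r0) //.
by rewrite lerDl.
Qed.

End Powers.

(** * Sinkhorn plans and barycentric targets *)

Section SinkhornPlan.
Context {R : realType} {N n : nat}.

(** Matrices all of whose entries are positive. *)
Definition positive_mx (K : 'M[R]_N) : Prop := forall i j, 0 < K i j.

Lemma mulmx_positive (K : 'M[R]_N) (b : 'cV[R]_N) :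
  positive_mx K -> positive_vec b -> positive_vec (K *m b).
Proof.
move=> hK hb i; rewrite mxE (bigD1 i) //= ltr_pwDl ?mulr_gt0 //.
by rewrite sumr_ge0 // => j _; rewrite mulr_ge0 // ltW.
Qed.

Lemma eldiv_uniform_positive (b : 'cV[R]_N) :
  positive_vec b -> positive_vec (eldiv uniform_vec b).
Proof.
move=> hb i; have N0 : (0 < N)%N := leq_ltn_trans (leq0n i) (ltn_ord i).
by rewrite !mxE divr_gt0 // divr_gt0 // ltr0n.
Qed.

Lemma sinkhorn_f_positive (K : 'M[R]_N) (b : 'cV[R]_N) :
  positive_mx K -> positive_vec b -> positive_vec (sinkhorn_f K b).
Proof.
move=> hK hb; apply/eldiv_uniform_positive/mulmx_positive.
  by move=> i j; rewrite mxE.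
exact/eldiv_uniform_positive/mulmx_positive.
Qed.

Lemma sinkhorn_planE (K : 'M[R]_N) (b : 'cV[R]_N) i j :
  sinkhorn_plan K b i j = 1 / N%:R / (K *m b) i 0 * (K i j * b j 0).
Proof.
by rewrite /sinkhorn_plan mul_mx_diag mxE mul_diag_mx !mxE mulrA.
Qed.

Lemma sinkhorn_plan_ge0 (K : 'M[R]_N) (b : 'cV[R]_N) i j :
  positive_mx K -> positive_vec b -> 0 <= sinkhorn_plan K b i j.
Proof.
move=> hK hb; rewrite sinkhorn_planE.
have Kb0 := ltW (mulmx_positive _ _ hK hb i).
have [Kij0 bj0] := (ltW (hK i j), ltW (hb j)).
by rewrite mulr_ge0 ?divr_ge0 ?mulr_ge0.
Qed.

Lemma sinkhorn_plan_row_sum (K : 'M[R]_N) (b : 'cV[R]_N) i :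
  positive_mx K -> positive_vec b ->
  \sum_j sinkhorn_plan K b i j = 1 / N%:R.
Proof.
move=> hK hb; have := mulmx_positive _ _ hK hb i.
under eq_bigr do rewrite sinkhorn_planE.
rewrite -mulr_sumr mxE => h; by rewrite mulfVK // gt_eqF.
Qed.

Lemma Kmat_positive m tauh (eps : R) (A : 'I_N -> 'M[R]_n)
    (B : 'I_N -> 'M[R]_(n, m)) (xd x : 'I_N -> 'cV[R]_n) :
  positive_mx (Kmat tauh eps A B xd x).
Proof. by move=> i j; rewrite mxE expR_gt0. Qed.

(** The target is a convex combination of the destinations, with weights
N P_ij. *)
Lemma enorm_xtmp_le (xd : 'I_N -> 'cV[R]_n) (P : 'M[R]_N) i :
  (forall j, 0 <= P i j) -> \sum_j P i j = 1 / N%:R ->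
  enorm (xtmp xd P i) <= rbar xd.
Proof.
move=> P0 P1; have N0 : (0 < N)%N := leq_ltn_trans (leq0n i) (ltn_ord i).
have N0' : (0 : R) < N%:R by rewrite ltr0n.
rewrite /xtmp enormZ gtr0_norm // -ler_pdivlMl //.
apply: le_trans (enorm_sum _ _ _) _.
have -> : N%:R^-1 * rbar xd = \sum_j P i j * rbar xd.
  by rewrite -mulr_suml P1 div1r.
apply: ler_sum => j _; rewrite enormZ ger0_norm // ler_wpM2l //.
exact: (le_bigmax (0 : R) (fun j => enorm (xd j)) j).
Qed.

Lemma closed_loop_beta_positive m tauh (eps : R) (A : 'I_N -> 'M[R]_n)
    (B : 'I_N -> 'M[R]_(n, m)) (xd : 'I_N -> 'cV[R]_n) x beta :
  closed_loop tauh eps A B xd x beta -> forall k, positive_vec (beta k).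
Proof.
case=> b0 _ hb; elim=> // k IHk i; have [c c0 ->] := hb k.
rewrite mxE mulr_gt0 //.
exact: (sinkhorn_f_positive _ _ (Kmat_positive _ _ _ _ _ _ _)).
Qed.

End SinkhornPlan.

(** * The perturbed linear recursion and the closed loop *)

(** The factor [M ^+ l] makes the induction on k go through: the step from k to
k + 1 uses the bound at k with l + 1. The second term, a multiple of
d r ^ l / (1 - r), is what remains of the geometric series of perturbations. *)
Lemma affine_recursion_bound (R : realType) n (M : 'M[R]_n)
    (y w : nat -> 'cV[R]_n) (kappa r d : R) :
  0 <= kappa -> 0 <= r < 1 -> 0 <= d ->
  (forall k v, enorm (M ^+ k *m v) <= kappa * r ^+ k * enorm v) ->
  (forall k, enorm (w k) <= d) ->
  (forall k, y k.+1 = M *m y k + w k) ->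
  forall k l, enorm (M ^+ l *m y k) <=
    kappa * r ^+ (k + l) * enorm (y 0%N) + kappa * d * r ^+ l / (1 - r).
Proof.
move=> kappa0 /andP[r0 r1] d0 hM hw hy.
have r1' : 0 < 1 - r by rewrite subr_gt0.
elim=> [|k IHk] l.
  apply: le_trans (hM l _) _; rewrite add0n lerDl.
  by rewrite divr_ge0 ?mulr_ge0 ?exprn_ge0 // ltW.
rewrite hy mulmxDr mulmxA -[M ^+ l *m M]/(M ^+ l * M) -exprSr.
apply: le_trans (enormD _ _ _) _.
have hl : enorm (M ^+ l *m w k) <= kappa * r ^+ l * d.
  by apply: le_trans (hM l _) _; rewrite ler_wpM2l // mulr_ge0 // exprn_ge0.
apply: le_trans (lerD (IHk l.+1) hl) _; rewrite addnS addSn -addrA lerD2l.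
by rewrite le_eqVlt exprS; apply/orP; left; apply/eqP; field; rewrite gt_eqF.
Qed.

Theorem proposition1 (R : realType) (N n m tauh : nat)
    (hN : (0 < N)%N) (hn : (0 < n)%N) (hm : (0 < m)%N) (htauh : (0 < tauh)%N)
    (eps : R) (heps : 0 < eps)
    (A : 'I_N -> 'M[R]_n) (B : 'I_N -> 'M[R]_(n, m)) (xd : 'I_N -> 'cV[R]_n)
    (hreach : forall i : 'I_N, gramian tauh (A i) (B i) \in unitmx)
    (hsteady : forall i j : 'I_N,
        exists u : 'cV[R]_m, A i *m xd j + B i *m u = xd j) :
  exists kappa : 'I_N -> R -> R,
    (forall (i : 'I_N) (nu : R),
        0 < nu -> spectral_radius (Abar tauh (A i) (B i)) + nu < 1 ->
        0 < kappa i nu) /\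
    forall (delta : R) (x0 : 'I_N -> 'cV[R]_n) (nu : 'I_N -> R),
      0 < delta ->
      (forall i : 'I_N, 0 < nu i /\
         spectral_radius (Abar tauh (A i) (B i)) + nu i < 1) ->
      exists tau : nat, (0 < tau)%N /\
        forall (x : nat -> 'I_N -> 'cV[R]_n) (beta : nat -> 'cV[R]_N),
          closed_loop tauh eps A B xd x beta ->
          (forall i : 'I_N, x 0%N i = x0 i) ->
          forall (k : nat) (i : 'I_N), (tau <= k)%N ->
            enorm (x k i) <
              delta + kappa i (nu i) * rbar xd
                        * opnorm2 (1%:M - Abar tauh (A i) (B i))
                      / (1 - (spectral_radius (Abar tauh (A i) (B i)) + nu i)).
Proof.
pose M i := Abar tauh (A i) (B i).
have [kappa hkappa] : exists kappa : 'I_N -> R -> R, forall i nu, 0 < nu ->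
    0 < kappa i nu /\ forall k v, enorm (M i ^+ k *m v) <=
      kappa i nu * (spectral_radius (M i) + nu) ^+ k * enorm v.
  have ex i (nu : R) : exists c : R, 0 < nu -> 0 < c /\ forall k v,
      enorm (M i ^+ k *m v) <= c * (spectral_radius (M i) + nu) ^+ k * enorm v.
    have [nu0|_] := ltP 0 nu; last by exists 0.
    by have [c c0 hc] := enorm_pow_mulmx_le _ (M i) nu nu0; exists c.
  have exf i := choice (ex i).
  by exists (fun i => projT1 (exf i)) => i; exact: (projT2 (exf i)).
exists kappa; split=> [i nu nu0 _|]; first by have [] := hkappa i nu nu0.
move=> delta x0 nu delta0 hnu.
pose r i := spectral_radius (M i) + nu i.
have r01 i : 0 <= r i < 1.
  have [nu0 r1] := hnu i; rewrite r1 andbT.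
  by rewrite addr_ge0 ?spectral_radius_ge0 // ltW.
(* The transient decays geometrically, and there are finitely many agents. *)
have [tau htau] : exists tau : nat, forall k i, (tau <= k)%N ->
    kappa i (nu i) * enorm (x0 i) * r i ^+ k < delta.
  have small i : (\forall k \near \oo,
      kappa i (nu i) * enorm (x0 i) * r i ^+ k < delta)%classic.
    have /andP[ri0 ri1] := r01 i.
    have ri : `|r i| < 1 by rewrite ger0_norm.
    have := cvg_geometric (kappa i (nu i) * enorm (x0 i)) ri.
    move/cvgrPdist_lt => /(_ _ delta0); apply: filterS => k /=.
    by rewrite sub0r normrN; apply: le_lt_trans; apply: ler_norm.
  have [tau _ htau] := filter_forall _ small.
  by exists tau => k i /htau /(_ i).
(* The successor only serves the positivity of the time. *)
exists tau.+1; split=> // x beta hcl hx0 k i hk.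
have hbeta := closed_loop_beta_positive _ _ _ _ _ _ _ _ hcl.
have [nu0 _] := hnu i; have [kappa0 hpow] := hkappa i (nu i) nu0.
have [_ hx _] := hcl.
pose w k := (1%:M - M i) *m
  xtmp xd (sinkhorn_plan (Kmat tauh eps A B xd (x k)) (beta k)) i.
pose d := opnorm2 (1%:M - M i) * rbar xd.
have hop (v : 'cV[R]_n) := enorm_mulmx_le_opnorm2 _ _ (1%:M - M i) v.
(* The bound on |(1 - M) v| forces a nonnegative norm once some v is nonzero;
   such a v exists because n > 0. *)
have op0 : 0 <= opnorm2 (1%:M - M i).
  have c0 : 0 < enorm (const_mx 1 : 'cV[R]_n).
    apply: lt_le_trans (normr_le_enorm _ _ (Ordinal hn)).
    by rewrite mxE normr1.
  by rewrite -(pmulr_lge0 _ c0) (le_trans _ (hop _)) // enorm_ge0.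
have hw k' : enorm (w k') <= d.
  apply: le_trans (hop _) _; rewrite ler_wpM2l //.
  apply: enorm_xtmp_le => [j|].
    by apply: sinkhorn_plan_ge0 => //; apply: Kmat_positive.
  by apply: sinkhorn_plan_row_sum => //; apply: Kmat_positive.
have d0 : 0 <= d := le_trans (enorm_ge0 _ _) (hw 0%N).
have := affine_recursion_bound _ _ (M i) (fun k => x k i) w _ _ d (ltW kappa0)
  (r01 i) d0 hpow hw (fun k => hx k i) k 0%N.
rewrite expr0 mul1mx addn0 mulr1 hx0 => h; apply: le_lt_trans h _.
have -> : kappa i (nu i) * rbar xd * opnorm2 (1%:M - M i) = kappa i (nu i) * d.
  by rewrite /d; ring.
by rewrite ltrD2r mulrAC htau // ltnW.
Qed.
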